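(* Let $D,N\ge1$, let $\bm X=[x_{dn}]\in\mathbb{R}^{D\times N}$ be arbitrary, let $\omega\in(0,1)$ (a scalar, possibly depending on $\bm X$), and define the mixed mean-max pooling $$f_{\mathrm{mix}}(\bm X)=\omega\,\mathrm{MeanPool}(\bm X)+(1-\omega)\,\mathrm{MaxPool}(\bm X),$$ where $\mathrm{MeanPool}(\bm X)=\frac1N\bm X\bm 1_N$ and $\mathrm{MaxPool}(\bm X)=\big(\max_{1\le n\le N}x_{dn}\big)_{d=1}^D$. Let $\mathrm{R}(\bm P)$ be either $\sum_{d,n}p_{dn}(\log p_{dn}-1)$ or $\|\bm P\|_F^2$, and let $f_{\mathrm{rot}}(\cdot\,;\bm\theta)$ be the regularized optimal transport pooling operation with the convention for infinite weights given in the context. Then $$f_{\mathrm{mix}}(\bm X)=f_{\mathrm{rot}}\big([f_{\mathrm{rot}}(\bm X;\bm\theta_1),\,f_{\mathrm{rot}}(\bm X;\bm\theta_2)];\,\bm\theta_3\big),$$ where $[\cdot,\cdot]$ denotes the $D\times2$ matrix with the given columns and $\bm\theta_1=\{0,\infty,\infty,\infty,\frac1D\bm 1_D,\frac1N\bm 1_N\}$, $\bm\theta_2=\{0,0,\infty,0,\frac1D\bm 1_D,\bm q_0\}$ with $\bm q_0$ an arbitrary vector, and $\bm\theta_3=\{0,\infty,\infty,\infty,\frac1D\bm 1_D,[\omega,1-\omega]^T\}$.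
   Context: Notation. $\bm 1_N$ is the all-one vector in $\mathbb{R}^N$; $\langle\cdot,\cdot\rangle$ is the Frobenius inner product; $\odot$ is the entrywise product; $\mathrm{diag}(\bm v)$ is the diagonal matrix with diagonal $\bm v$ and $\mathrm{diag}^{-1}(\bm v)$ its inverse; $0\log0=0$. Regularized optimal transport (ROT) problem. For a matrix $\bm X\in\mathbb{R}^{D\times N}$ (any $N\ge 1$) and parameters $\bm\theta=\{\alpha_0,\alpha_1,\alpha_2,\alpha_3,\bm p_0,\bm q_0\}$ (listed in this order) it is the minimization, over nonnegative $\bm P=[p_{dn}]\in\mathbb{R}^{D\times N}$ with $\bm 1_D^T\bm P\bm 1_N=1$, of $$\langle-\bm X,\bm P\rangle+\alpha_0\langle C(\bm X,\bm P),\bm P\rangle+\alpha_1\mathrm{R}(\bm P)+\alpha_2\mathrm{KL}(\bm P\bm 1_N|\bm p_0)+\alpha_3\mathrm{KL}(\bm P^T\bm 1_D|\bm q_0),$$ where $C(\bm X,\bm P)=-\bm\Sigma_1\bm P\bm\Sigma_2^T$ with $\bm\Sigma_1,\bm\Sigma_2$ the covariance matrices of the rows and of the columns of $\bm X$ (this term is irrelevant when $\alpha_0=0$), and $\mathrm{KL}(\bm a|\bm b)=\langle\bm a,\log\bm a-\log\bm b\rangle-\langle\bm a-\bm b,\bm 1\rangle$. Convention for the values $0$ and $\infty$ of the weights. A term with weight $0$ is removed. Weight $\alpha_2=\infty$ means that the term $\alpha_2\mathrm{KL}(\bm P\bm 1_N|\bm p_0)$ is replaced by the strict constraint $\bm P\bm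 1_N=\bm p_0$; weight $\alpha_3=\infty$ means that the term $\alpha_3\mathrm{KL}(\bm P^T\bm 1_D|\bm q_0)$ is replaced by the strict constraint $\bm P^T\bm 1_D=\bm q_0$; weight $\alpha_1=\infty$ means that the smoothness regularizer is dominant, so that the term $\langle-\bm X,\bm P\rangle$ is dropped and the objective is $\mathrm{R}(\bm P)$. Pooling operation. With $\bm P^*$ an optimal solution of the ROT problem with parameters $\bm\theta$, $$f_{\mathrm{rot}}(\bm X;\bm\theta)=\big(\bm X\odot(\mathrm{diag}^{-1}(\bm P^*\bm 1_N)\,\bm P^* )\big)\bm 1_N\in\mathbb{R}^D.$$ If the optimal solution is not unique, the assertion is meant for every choice of $\bm P^*$. *)

(* Defs.v *)
From HB Require Import structures.
From mathcomp Require Import all_boot all_order all_algebra.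
From mathcomp Require Import all_classical all_reals all_analysis.
Set Implicit Arguments.
Unset Strict Implicit.
Unset Printing Implicit Defensive.
Import Order.TTheory GRing.Theory Num.Theory.
Local Open Scope ring_scope.
Local Open Scope classical_set_scope.

(* Regularized optimal transport (ROT) pooling of a matrix X : 'M[R]_(D, N).  *)

Section MatrixNotions.
Variable R : realType.

Definition ones (n : nat) : 'cV[R]_n := const_mx 1.

Definition frob (m n : nat) (A B : 'M[R]_(m, n)) : R :=
  \sum_i \sum_j A i j * B i j.

Definition hadamard (m n : nat) (A B : 'M[R]_(m, n)) : 'M[R]_(m, n) :=
  map2_mx *%R A B.

Definition diagc (n : nat) (v : 'cV[R]_n) : 'M[R]_n := diag_mx v^T.

(* The m samples are the rows of A; the normalization is 1/n. *)
Definition row_cov (m n : nat) (A : 'M[R]_(m, n)) : 'M[R]_m :=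
  let Ac := A - (n%:R^-1 *: (A *m ones n)) *m (ones n)^T in
  n%:R^-1 *: (Ac *m Ac^T).

End MatrixNotions.
Arguments ones {R} n.

Section ROT.
Variable R : realType.

Variant regularizer := Entropic | Quadratic.

(* ln 0 = 0 in the library, so a zero entry contributes 0 to the entropy. *)
Definition reg_fun (reg : regularizer) (D N : nat) (P : 'M[R]_(D, N)) : R :=
  match reg with
  | Entropic => \sum_d \sum_n P d n * (ln (P d n) - 1)
  | Quadratic => frob P P
  end.

(* Extended-valued: lne is -oo at 0 and 0 * (-oo) = 0 in \bar R, hence        *)
(* 0 log 0 = 0, and an entry with b = 0 < a contributes +oo.                  *)
Definition KL (n : nat) (a b : 'cV[R]_n) : \bar R :=
  ((\sum_i (a i ord0)%:E * (lne (a i ord0)%:E - lne (b i ord0)%:E))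
   - (\sum_i (a i ord0 - b i ord0)%R)%:E)%E.

(* The weights alpha1, alpha2, alpha3 range over [0, +oo].                    *)
Record rot_param (D N : nat) := RotParam {
  alpha0 : R;
  alpha1 : \bar R;
  alpha2 : \bar R;
  alpha3 : \bar R;
  p0 : 'cV[R]_D;
  q0 : 'cV[R]_N
}.

Definition structure_cost (D N : nat) (X P : 'M[R]_(D, N)) : 'M[R]_(D, N) :=
  - (row_cov X *m P *m (row_cov X^T)^T).

Definition KL_term (n : nat) (w : \bar R) (a b : 'cV[R]_n) : \bar R :=
  (if w == +oo then 0 else w * KL a b)%E.

(* A term of weight 0 vanishes, whatever its value, since 0 * x = 0 in \bar R. *)
Definition rot_objective (reg : regularizer) (D N : nat)
    (theta : rot_param D N) (X P : 'M[R]_(D, N)) : \bar R :=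
  (if alpha1 theta == +oo then (reg_fun reg P)%:E
   else (frob (- X) P + alpha0 theta * frob (structure_cost X P) P)%R%:E
        + alpha1 theta * (reg_fun reg P)%:E
        + KL_term (alpha2 theta) (P *m ones N) (p0 theta)
        + KL_term (alpha3 theta) (P^T *m ones D) (q0 theta))%E.

Definition rot_feasible (D N : nat) (theta : rot_param D N)
    (P : 'M[R]_(D, N)) : Prop :=
  [/\ forall d n, 0 <= P d n,
      (ones D)^T *m P *m ones N = 1%:M,
      alpha2 theta = +oo%E -> P *m ones N = p0 theta
    & alpha3 theta = +oo%E -> P^T *m ones D = q0 theta].

Definition rot_optimal (reg : regularizer) (D N : nat) (theta : rot_param D N)
    (X P : 'M[R]_(D, N)) : Prop :=
  rot_feasible theta P /\
  forall Q, rot_feasible theta Q ->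
    (rot_objective reg theta X P <= rot_objective reg theta X Q)%E.

Definition rot_pool (D N : nat) (X P : 'M[R]_(D, N)) : 'cV[R]_D :=
  hadamard X (invmx (diagc (P *m ones N)) *m P) *m ones N.

(* The set of values of the ROT pooling of X, over all optimal solutions.     *)
Definition f_rot (reg : regularizer) (D N : nat) (X : 'M[R]_(D, N))
    (theta : rot_param D N) : set 'cV[R]_D :=
  [set rot_pool X P | P in [set P | rot_optimal reg theta X P]].

Definition mean_pool (D N : nat) (X : 'M[R]_(D, N)) : 'cV[R]_D :=
  N%:R^-1 *: (X *m ones N).

Definition max_pool (D N : nat) (X : 'M[R]_(D, N.+1)) : 'cV[R]_D :=
  \col_d \big[Num.max/X d ord0]_(n < N.+1) X d n.

Definition f_mix (D N : nat) (w : R) (X : 'M[R]_(D, N.+1)) : 'cV[R]_D :=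
  w *: mean_pool X + (1 - w) *: max_pool X.

End ROT.
Arguments RotParam {R D N}.

(* Main.v *)
(* When the smoothness regularizer is dominant, it separates over the entries
   and is strictly convex, so its tangent inequality at t_j = q_j / D, summed
   against the column constraint, forces every column of P to be constant; the
   unique optimum is (1/D) 1 q^T, and pooling is then X |-> X q.  This covers
   both theta1 (q uniform: mean pooling) and theta3 (q = (w, 1 - w)).  For
   theta2 the problem is linear and separates over the rows, so each row of an
   optimum only charges its maxima, and every optimum pools to the maximum. *)
Require Import Defs.
From HB Require Import structures.
From mathcomp Require Import all_boot all_order all_algebra.
From mathcomp Require Import all_classical all_reals all_analysis.
From mathcomp Require Import ring.
Set Implicit Arguments.
Unset Strict Implicit.
Unset Printing Implicit Defensive.
Import Order.TTheory GRing.Theory Num.Theory.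
Local Open Scope ring_scope.
Local Open Scope classical_set_scope.

Section UniformRowMarginal.
Variables (R : realType) (reg : regularizer).

Definition unif (n : nat) : 'cV[R]_n := n%:R^-1 *: ones n.

Definition reg_density (p : R) : R :=
  match reg with Entropic => p * (ln p - 1) | Quadratic => p * p end.

(** The derivative of [reg_density] at [t > 0]; the [- 1] in the entropic density makes it exactly
    [ln t]. *)
Definition reg_slope (t : R) : R :=
  match reg with Entropic => ln t | Quadratic => 2 * t end.

Lemma reg_funE (m n : nat) (P : 'M[R]_(m, n)) :
  reg_fun reg P = \sum_i \sum_j reg_density (P i j).
Proof. by rewrite /reg_density; case: reg. Qed.

Lemma unifE (n : nat) i : unif n i ord0 = n%:R^-1.
Proof. by rewrite !mxE mulr1. Qed.

Lemma mulmx_onesE (m n : nat) (A : 'M[R]_(m, n)) i :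
  (A *m ones n) i ord0 = \sum_j A i j.
Proof. by rewrite mxE; apply: eq_bigr => j _; rewrite !mxE mulr1. Qed.

(** This is [1 + y <= expR y] at [y = ln x], strict unless [y = 0]; that strictness is what makes
    the entropic optimum unique. *)
Lemma ln_leif (x : R) : 0 < x -> ln x <= x - 1 ?= iff (x == 1).
Proof.
move=> x0; have lnx : expR (ln x) = x by exact: lnK.
split; first by rewrite lerBrDl -[leRHS]lnx expR_ge1Dx.
apply/eqP/eqP => [e|->]; last by rewrite ln1 subrr.
apply/eqP; rewrite -ln_eq0//; apply: contraT => /expR_gt1Dx.
by rewrite lnx e subrKC ltxx.
Qed.

(* For the entropy the gap is p (t / p - 1 - ln (t / p)), and t if p = 0. *)
Lemma reg_tangent (t p : R) : 0 < t -> 0 <= p ->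
  reg_density t + reg_slope t * (p - t) <= reg_density p ?= iff (p == t).
Proof.
rewrite /reg_density /reg_slope => t0 p0; case: reg; last first.
  (* In the quadratic case the gap is [(p - t) ^+ 2]. *)
  rewrite -subr_eq0 -sqrf_eq0; split; last rewrite -[LHS]subr_eq0 -oppr_eq0.
    by rewrite -subr_ge0 (_ : _ - _ = (p - t) ^+ 2) ?sqr_ge0//; ring.
  by congr (_ == _); ring.
have -> : t * (ln t - 1) + ln t * (p - t) = ln t * p - t by ring.
have [->|pn0] := eqVneq p 0.
  rewrite mulr0 sub0r mul0r; split; first by rewrite oppr_le0 ltW.
  by rewrite oppr_eq0 eq_sym.
have {pn0}pp : 0 < p by rewrite lt_def pn0.
have /ln_leif : 0 < t / p by rewrite divr_gt0.
rewrite ln_div ?posrE// => -[le_ln eq_ln].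
have pE : ln t * p - t - p * (ln p - 1) = p * (ln t - ln p - (t / p - 1)).
  by field; rewrite gt_eqF.
split.
  by rewrite -subr_le0 pE pmulr_rle0// subr_le0.
rewrite -subr_eq0 pE mulf_eq0 gt_eqF//= subr_eq0 eq_ln.
by rewrite -[1 in LHS]divr1 eqr_div ?lt0r_neq0 // mulr1 mul1r eq_sym.
Qed.

(** Positivity of [q] keeps every tangent point in the domain of [reg_tangent], while [P] may have
    zeros. Summing with [leif] yields minimality and uniqueness together. *)
Lemma reg_fun_leif (m n : nat) (q : 'cV[R]_n) (P : 'M[R]_(m.+1, n)) :
  (forall j, 0 < q j ord0) -> (forall i j, 0 <= P i j) ->
  P^T *m ones m.+1 = q ->
  reg_fun reg (unif m.+1 *m q^T) <= reg_fun reg P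
    ?= iff (P == unif m.+1 *m q^T).
Proof.
move=> q0 P0 Pq; set T := unif m.+1 *m q^T.
have TE i j : T i j = m.+1%:R^-1 * q j ord0.
  by rewrite mxE big_ord1 unifE mxE.
have T0 i j : 0 < T i j by rewrite TE mulr_gt0// invr_gt0.
(* The slope depends on j only and the j-th columns of P and T have equal sums. *)
have -> : reg_fun reg T = \sum_i \sum_j
    (reg_density (T i j) + reg_slope (T i j) * (P i j - T i j)).
  rewrite reg_funE; under [RHS]eq_bigr do rewrite big_split/=.
  rewrite big_split/= [X in _ + X]exchange_big/=.
  rewrite [X in _ + X]big1 ?addr0// => j _.
  under eq_bigr do rewrite TE.
  rewrite -mulr_sumr sumrB sumr_const card_ord -(mulr_natl (_ * _)) mulVKf//.
  have -> : \sum_i P i j = q j ord0.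
    by rewrite -Pq mulmx_onesE; apply: eq_bigr => i _; rewrite mxE.
  by rewrite subrr mulr0.
have -> : (P == T) = [forall i, [forall j, P i j == T i j]].
  apply/eqP/'forall_'forall_eqP => [-> //|e].
  by apply/matrixP => i j; exact: e.
rewrite reg_funE; apply: leif_sum => i _; apply: leif_sum => j _.
exact: reg_tangent.
Qed.

(** For a uniform row marginal the normalizing diagonal matrix is scalar, so inverting it amounts to
    multiplying by [m]. *)
Lemma rot_pool_unif (m n : nat) (X P : 'M[R]_(m, n)) i :
  P *m ones n = unif m ->
  rot_pool X P i ord0 = m%:R * \sum_j X i j * P i j.
Proof.
move=> Pu; rewrite /rot_pool Pu.
have -> : diagc (unif m) = (m%:R^-1)%:M.
  by rewrite /diagc; apply/matrixP => k l; rewrite !mxE mulr1.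
rewrite invmx_scalar invrK mul_scalar_mx mulmx_onesE mulr_sumr.
by apply: eq_bigr => j _; rewrite !mxE mulrCA.
Qed.

Lemma total_mass_unif (m n : nat) (P : 'M[R]_(m.+1, n)) :
  P *m ones n = unif m.+1 -> (ones m.+1)^T *m P *m ones n = 1%:M.
Proof.
move=> Pu; rewrite -mulmxA Pu; apply/matrixP => i j; rewrite !ord1 !mxE eqxx.
under eq_bigr do rewrite unifE !mxE mul1r.
by rewrite sumr_const card_ord -[LHS]mulr_natl mulfV.
Qed.

Lemma f_rot_dominant (m n : nat) (X : 'M[R]_(m.+1, n)) (q : 'cV[R]_n) :
  (forall j, 0 < q j ord0) -> \sum_j q j ord0 = 1 ->
  f_rot reg X (RotParam 0 +oo%E +oo%E +oo%E (unif m.+1) q) = [set X *m q].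
Proof.
move=> q0 q1; set theta := RotParam _ _ _ _ _ _; set T := unif m.+1 *m q^T.
have Tu : T *m ones n = unif m.+1.
  rewrite -mulmxA; apply/matrixP => i j; rewrite ord1 mxE big_ord1 mulmx_onesE.
  by under eq_bigr do rewrite mxE; rewrite q1 mulr1.
have Tq : T^T *m ones m.+1 = q.
  rewrite trmx_mul trmxK -mulmxA; apply/matrixP => j k.
  rewrite ord1 mxE big_ord1 mulmx_onesE.
  under eq_bigr do rewrite mxE unifE.
  by rewrite sumr_const card_ord -[_ *+ _]mulr_natl mulfV// mulr1.
have Tf : rot_feasible theta T.
  split=> // [i j|]; last exact: total_mass_unif.
  by rewrite mxE big_ord1 unifE mxE mulr_ge0 ?invr_ge0// ltW.
have Tle P : rot_feasible theta P ->
    reg_fun reg T <= reg_fun reg P ?= iff (P == T).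
  by move=> [P0 _ _ /(_ erefl)]; exact: reg_fun_leif.
have objE P : rot_objective reg theta X P = (reg_fun reg P)%:E by [].
have poolT : rot_pool X T = X *m q.
  apply/matrixP => i j; rewrite ord1 rot_pool_unif// mxE mulr_sumr.
  apply: eq_bigr => k _; rewrite [T _ _]mxE big_ord1 unifE mxE.
  by rewrite mulrCA mulVKf.
apply/seteqP; split=> [y [P [Pf Popt] <-]|_ ->] /=.
  (* The value at an optimum [P] is at most that at [T], so the equality case of [Tle] gives
     [P = T]. *)
  rewrite -poolT; congr rot_pool; apply/eqP; rewrite -(ge_leif (Tle P Pf)).
  by have := Popt _ Tf; rewrite !objE lee_fin.
exists T => //; split=> // P Pf; rewrite !objE lee_fin.
exact: (Tle P Pf).1.
Qed.

Lemma max_poolP (m n : nat) (X : 'M[R]_(m, n.+1)) i :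
  (forall j, X i j <= max_pool X i ord0) /\ exists j, X i j = max_pool X i ord0.
Proof.
rewrite mxE; split=> [j|]; first exact: le_bigmax.
(* The default value of the maximum is itself the entry in column [ord0], so the base case is
   attained too. *)
elim/big_ind: _ => [|x y [j jx] [k ky]|j _]; first by exists ord0.
  by rewrite /Num.max; case: ifP => _; [exists k|exists j].
by exists j.
Qed.

(** Ties within a row make the optimum non-unique, but by [rot_pool_unif] pooling sees [P] only
    through the sums [\sum_j X i j * P i j], which all optima share. *)
Lemma f_rot_linear (m n : nat) (X : 'M[R]_(m.+1, n.+1)) (q : 'cV[R]_n.+1) :
  f_rot reg X (RotParam 0 0%E +oo%E 0%E (unif m.+1) q) = [set max_pool X].
Proof.
set theta := RotParam _ _ _ _ _ _.
have objE P : rot_objective reg theta X P = (frob (- X) P)%:E.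
  by rewrite /rot_objective /KL_term/= !mul0e mul0r !adde0 addr0.
have frobE P : frob (- X) P = - \sum_i \sum_j X i j * P i j.
  rewrite /frob -sumrN; apply: eq_bigr => i _; rewrite -sumrN.
  by apply: eq_bigr => j _; rewrite mxE mulNr.
have Ple P : rot_feasible theta P ->
    \sum_i \sum_j X i j * P i j <= \sum_i m.+1%:R^-1 * max_pool X i ord0
    ?= iff [forall i, \sum_j X i j * P i j == m.+1%:R^-1 * max_pool X i ord0].
  move=> [P0 _ /(_ erefl) Pu _]; apply: leif_sum => i _; split=> //.
  have <- : \sum_j P i j = m.+1%:R^-1 by rewrite -mulmx_onesE Pu unifE.
  rewrite mulrC mulr_sumr; apply: ler_sum => j _; apply: ler_wpM2r => //.
  exact: (max_poolP X i).1.
(* [k] selects a maximal column in each row, and [T] puts the whole mass of the row there, so the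
   bound [Ple] is attained. *)
have [k kP] := choice (fun i => (max_poolP X i).2).
pose T : 'M[R]_(m.+1, n.+1) := \matrix_(i, j) (m.+1%:R^-1 *+ (j == k i)).
have Tu : T *m ones n.+1 = unif m.+1.
  apply/matrixP => i j; rewrite ord1 mulmx_onesE unifE (bigD1 (k i))//= mxE eqxx.
  by rewrite big1 ?addr0// => l /negPf lk; rewrite mxE lk.
have Tf : rot_feasible theta T.
  split=> // [i j|]; last exact: total_mass_unif.
  by rewrite mxE mulrn_wge0 ?invr_ge0.
have TE i : \sum_j X i j * T i j = m.+1%:R^-1 * max_pool X i ord0.
  rewrite (bigD1 (k i))//= big1 => [|l /negPf lk]; last by rewrite mxE lk mulr0.
  by rewrite addr0 [T _ _]mxE eqxx mulr1n kP mulrC.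
have poolE P : P *m ones n.+1 = unif m.+1 ->
    (forall i, \sum_j X i j * P i j = m.+1%:R^-1 * max_pool X i ord0) ->
    rot_pool X P = max_pool X.
  move=> Pu PE; apply/matrixP => i j.
  by rewrite ord1 rot_pool_unif// PE mulVKf.
apply/seteqP; split=> [y [P [Pf Popt] <-]|_ ->] /=.
  (* An optimum does at least as well as [T], hence reaches the bound of [Ple]; equality in the sum
     forces equality in each row. *)
  have [_ _ /(_ erefl) Pu _] := Pf; apply: poolE => // i; apply/eqP.
  move: i; apply/forallP; rewrite -(ge_leif (Ple P Pf)).
  have := Popt _ Tf; rewrite !objE lee_fin !frobE lerN2.
  by under eq_bigr do rewrite TE.
exists T; last exact: poolE.
split=> // P Pf; rewrite !objE lee_fin !frobE lerN2.
by under [leRHS]eq_bigr do rewrite TE; exact: (Ple P Pf).1.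
Qed.

End UniformRowMarginal.

Theorem proposition2 (R : realType) (reg : regularizer) (D N : nat)
    (X : 'M[R]_(D.+1, N.+1)) (w : R) (hw0 : 0 < w) (hw1 : w < 1)
    (q : 'cV[R]_N.+1) :
  let unifD : 'cV[R]_D.+1 := D.+1%:R^-1 *: ones D.+1 in
  let unifN : 'cV[R]_N.+1 := N.+1%:R^-1 *: ones N.+1 in
  let mixw : 'cV[R]_2 := \col_(i < 2) [:: w; 1 - w]`_i in
  let theta1 := RotParam 0 +oo%E +oo%E +oo%E unifD unifN in
  let theta2 := RotParam 0 0%E +oo%E 0%E unifD q in
  let theta3 := RotParam 0 +oo%E +oo%E +oo%E unifD mixw in
  [/\ f_rot reg X theta1 !=set0,
      f_rot reg X theta2 !=set0
    & forall y1 y2 : 'cV[R]_D.+1,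
        f_rot reg X theta1 y1 -> f_rot reg X theta2 y2 ->
        f_rot reg (row_mx y1 y2 : 'M[R]_(D.+1, 2)) theta3
        = [set f_mix w X]].
Proof.
move=> unifD unifN mixw theta1 theta2 theta3.
have E1 : f_rot reg X theta1 = [set mean_pool X].
  rewrite /mean_pool scalemxAr; apply: f_rot_dominant => [j|].
    by rewrite unifE invr_gt0.
  under eq_bigr do rewrite unifE.
  by rewrite sumr_const card_ord -[LHS]mulr_natl mulfV.
have E2 : f_rot reg X theta2 = [set max_pool X] := f_rot_linear reg X q.
rewrite E1 E2; split; [by eexists|by eexists|move=> _ _ -> ->].
rewrite f_rot_dominant => [|j|].
- congr [set _]; apply/matrixP => i j; rewrite ord1 mxE big_ord_recl big_ord1.
  (* With [2] read as [1 + 1], the two column indices agree with those of [row_mxEl] and [row_mxEr]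
     only in value, hence [val_inj]. *)
  set M := row_mx _ _; have -> : M i ord0 = mean_pool X i ord0.
    by rewrite -(row_mxEl (mean_pool X) (max_pool X)) -/M; congr (M _ _); exact: val_inj.
  have -> : M i (lift ord0 ord0) = max_pool X i ord0.
    by rewrite -(row_mxEr (mean_pool X) (max_pool X)) -/M; congr (M _ _); exact: val_inj.
  by rewrite /f_mix !mxE/= mulrC [X in _ + X]mulrC.
(* Both bounds on [w] enter here: the column marginal must be positive. *)
- by rewrite mxE; case: j => -[|[|//]] /= _; rewrite ?subr_gt0.
- by rewrite big_ord_recl big_ord1 !mxE/= subrKC.
Qed.
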